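(* For every prime $p$, $\widetilde{\mathbb{Q}_p}=\mathbb{Q}_p^{\mathrm{alg}}$, where $\mathbb{Q}_p^{\mathrm{alg}}=\{x\in\mathbb{Q}_p: x\text{ is algebraic over }\mathbb{Q}\}$.
   Context: Let $K$ be a field. For $r\in K$, a finite set $A(r)$ with $\{r\}\subseteq A(r)\subseteq K$ is called adequate for $r$ if every mapping $f:A(r)\to K$ satisfying (1) if $1\in A(r)$ then $f(1)=1$; (2) if $a,b\in A(r)$ and $a+b\in A(r)$ then $f(a+b)=f(a)+f(b)$; (3) if $a,b\in A(r)$ and $a\cdot b\in A(r)$ then $f(a\cdot b)=f(a)\cdot f(b)$, also satisfies $f(r)=r$. $\widetilde{K}$ denotes the set of all $r\in K$ for which some finite set adequate for $r$ exists. $\mathbb{Q}_p$ is the field of $p$-adic numbers. *)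

(* Defs.v *)
(* Q_p is constructed as the completion of Q for the p-adic
   absolute value: Cauchy sequences of rationals modulo null sequences. *)
From Stdlib Require Import ClassicalEpsilon.
From Stdlib Require List.
From mathcomp Require Import all_boot all_order all_algebra.
Set Implicit Arguments. Unset Strict Implicit. Unset Printing Implicit Defensive.
Import Order.TTheory GRing.Theory Num.Theory.
Local Open Scope ring_scope.

Section Adequate.
Variables (K : Type) (add mul : K -> K -> K) (one : K).

(* f : A -> K is represented by a total f : K -> K; only its values on A
   matter, and every map A -> K extends to K -> K. *)
Definition adequate_hom (A : list K) (f : K -> K) : Prop :=
  (List.In one A -> f one = one) /\
  (forall a b, List.In a A -> List.In b A -> List.In (add a b) A ->
     f (add a b) = add (f a) (f b)) /\
  (forall a b, List.In a A -> List.In b A -> List.In (mul a b) A ->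
     f (mul a b) = mul (f a) (f b)).

Definition adequate (r : K) (A : list K) : Prop :=
  List.In r A /\ forall f : K -> K, adequate_hom A f -> f r = r.

Definition in_tilde (r : K) : Prop := exists A : list K, adequate r A.
End Adequate.

Definition padic_val (p : nat) (q : rat) : int :=
  (logn p `|numq q|%N)%:Z - (logn p `|denq q|%N)%:Z.

Definition padic_norm (p : nat) (q : rat) : rat :=
  if q == 0 then 0 else (p%:R : rat) ^ (- padic_val p q).

Definition padic_cauchy (p : nat) (u : nat -> rat) : Prop :=
  forall eps : rat, 0 < eps -> exists N : nat,
    forall m n : nat, (N <= m)%N -> (N <= n)%N -> padic_norm p (u m - u n) < eps.

Definition padic_equiv (p : nat) (u v : nat -> rat) : Prop :=
  forall eps : rat, 0 < eps -> exists N : nat,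
    forall n : nat, (N <= n)%N -> padic_norm p (u n - v n) < eps.

Definition padic_cls (p : nat) (u : nat -> rat) : (nat -> rat) -> Prop :=
  fun v => padic_cauchy p v /\ padic_equiv p u v.

Definition Qp (p : nat) : Type :=
  { S : (nat -> rat) -> Prop | exists u, padic_cauchy p u /\ S = padic_cls p u }.

Lemma padic_cst_cauchy (p : nat) (q : rat) : padic_cauchy p (fun _ => q).
Proof. by move=> eps he; exists 0%N => m n _ _; rewrite subrr /padic_norm eqxx. Qed.

Definition Qp_of_rat (p : nat) (q : rat) : Qp p :=
  exist _ (padic_cls p (fun _ => q))
        (ex_intro _ (fun _ => q) (conj (padic_cst_cauchy p q) erefl)).

Definition Qp_rep (p : nat) (X : Qp p) : nat -> rat :=
  proj1_sig (constructive_indefinite_description _ (proj2_sig X)).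

Definition Qp_lift2 (p : nat) (op : rat -> rat -> rat) (X Y : Qp p) : Qp p :=
  epsilon (inhabits (Qp_of_rat p 0))
    (fun Z : Qp p => proj1_sig Z (fun n => op (Qp_rep X n) (Qp_rep Y n))).

Definition Qp_add (p : nat) : Qp p -> Qp p -> Qp p := @Qp_lift2 p +%R.
Definition Qp_mul (p : nat) : Qp p -> Qp p -> Qp p := @Qp_lift2 p *%R.
Definition Qp_one (p : nat) : Qp p := Qp_of_rat p 1.

(* evaluation of a rational polynomial (coefficient list, low degree first) *)
Definition Qp_horner (p : nat) (P : {poly rat}) (x : Qp p) : Qp p :=
  foldr (fun c acc => Qp_add (Qp_of_rat p c) (Qp_mul acc x))
        (Qp_of_rat p 0) (polyseq P).

Definition Qp_algebraic (p : nat) (x : Qp p) : Prop :=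
  exists P : {poly rat}, P != 0 /\ Qp_horner P x = Qp_of_rat p 0.

(* Main.v *)
(** For the easy inclusion, let [x] be a root of [P <> 0] over the rationals.
The valuation ring of Q_p is existentially definable ([t] is integral iff
[y^2 + y = p t^2] has a solution), so a finite set can force [f x] to be a root
of [P] that is as close to [x] as we like; the roots of [P] being isolated,
[f x = x].

Conversely, let [x] be transcendental and [A] finite. We deform the inclusion
of the ring generated by [A]: there are a ring [D], a morphism [phi] from [D]
to Q_p whose image contains [A], and morphisms [phi_n] converging pointwise to
[phi], such that every element of the kernel of [phi] is killed by [phi_n] for
large [n]. One starts from [D = Q[X]] with [phi], [phi_n] the evaluations at [x]
and [x + p^n], and adjoins the elements [a] of [A] one by one: if [a] is
algebraic over the image of [D], Hensel's lemma moves it along with the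
coefficients of its minimal equation; otherwise it is kept fixed. For large [n],
[phi_n] then induces a map on [A] that respects all sums and products in [A] but
sends [x] to [x + p^n]. *)
Require Import Defs.
From HB Require Import structures.
From Stdlib Require Import ClassicalEpsilon.
From Stdlib Require List.
From mathcomp Require Import all_boot all_order all_algebra.
From mathcomp Require Import ring lra zify.
From mathcomp Require Import boolp.
Set Implicit Arguments. Unset Strict Implicit. Unset Printing Implicit Defensive.
Import Order.TTheory GRing.Theory Num.Theory.
Local Open Scope ring_scope.

(** * Ultrametric fields and Hensel's lemma *)

Definition eventually (P : nat -> Prop) := exists N, forall n, (N <= n)%N -> P n.

Lemma eventuallyT (P : nat -> Prop) : (forall n, P n) -> eventually P.
Proof. by move=> PT; exists 0%N. Qed.

Lemma eventually_mono (P Q : nat -> Prop) :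
  (forall n, P n -> Q n) -> eventually P -> eventually Q.
Proof. by move=> PQ [N HN]; exists N => n /HN/PQ. Qed.

Lemma eventually_and (P Q : nat -> Prop) :
  eventually P -> eventually Q -> eventually (fun n => P n /\ Q n).
Proof.
move=> [N HN] [M HM]; exists (maxn N M) => n; rewrite geq_max => /andP[hN hM].
by split; [apply: HN | apply: HM].
Qed.

Lemma eventually_ltn (P : nat -> nat -> Prop) k :
  (forall i, eventually (P i)) -> eventually (fun n => forall i, (i < k)%N -> P i n).
Proof.
move=> evP; elim: k => [|k IHk]; first exact: eventuallyT.
apply: eventually_mono (eventually_and IHk (evP k)) => n [Hk Pk] i.
by rewrite ltnS leq_eqVlt => /predU1P[->//|/Hk].
Qed.

(** Finiteness of the list makes the thresholds uniform; this is how the finiteness of an adequate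
    set enters in [in_tilde_algebraic]. *)
Lemma eventually_In (T : Type) (P : T -> nat -> Prop) (s : list T) :
  (forall a, List.In a s -> eventually (P a)) ->
  eventually (fun n => forall a, List.In a s -> P a n).
Proof.
elim: s => [|b s IHs] evP; first exact: eventuallyT.
have evs := IHs (fun a sa => evP a (or_intror sa)).
apply: eventually_mono (eventually_and evs (evP b (or_introl erefl))) => n [Hs Pb] a.
by case=> [<-|/Hs].
Qed.

Lemma eventually_ex (P : nat -> Prop) : eventually P -> exists n, P n.
Proof. by move=> [N HN]; exists N; apply: HN. Qed.

(** Bernoulli's inequality for [1 / k = 1 + h], combined with the archimedean property of the
    rationals. *)
Lemma expr_lt_eps (k e : rat) : 0 <= k < 1 -> 0 < e -> exists N, k ^+ N < e.
Proof.
move=> /andP[k0 k1] e0; have [->|kn0] := eqVneq k 0; first by exists 1%N.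
have kp : 0 < k by rewrite lt_neqAle eq_sym kn0.
pose h := k^-1 - 1.
have hp : 0 < h by rewrite subr_gt0 invf_gt1.
have bern n : 1 + n%:R * h <= (1 + h) ^+ n.
  elim: n => [|n IHn]; first by rewrite mul0r addr0 expr0.
  rewrite exprS; apply: le_trans (_ : (1 + h) * (1 + n%:R * h) <= _).
    have : 0 <= n%:R * h ^+ 2 by rewrite mulr_ge0 ?ler0n ?sqr_ge0.
    rewrite -[n.+1]addn1 natrD; nra.
  by rewrite ler_pM2l //; lra.
have eh : 0 < e * h by rewrite mulr_gt0.
pose N := Num.bound (e * h)^-1.
have hN : (e * h)^-1 < N%:R.
  by apply: archi_boundP; rewrite invr_ge0 ltW.
exists N.
have -> : k = (1 + h)^-1 by rewrite /h addrC subrK invrK.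
rewrite exprVn invf_plt ?posrE ?exprn_gt0 //; last by lra.
apply: lt_le_trans (bern N).
apply: lt_trans (_ : N%:R * h < _); last by lra.
by rewrite -ltr_pdivrMr // -invfM.
Qed.

(** Rational values are enough to cover the p-adic norm, which takes only the value zero and integer
    powers of [p]. *)
Record ultrametric (K : fieldType) (nm : K -> rat) : Prop := Ultrametric {
  nm_ge0 : forall x, 0 <= nm x;
  nm_eq0 : forall x, nm x = 0 -> x = 0;
  nm0 : nm 0 = 0;
  nmM : forall x y, nm (x * y) = nm x * nm y;
  nmD : forall x y, nm (x + y) <= Num.max (nm x) (nm y)
}.

Section Ultrametric.
Variables (K : fieldType) (nm : K -> rat) (um : ultrametric nm).
Implicit Types (u v : nat -> K) (x y l : K) (e : rat).

Lemma nm_gt0 x : x != 0 -> 0 < nm x.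
Proof.
move=> x0; rewrite lt_neqAle nm_ge0 // andbT eq_sym.
by apply: contraNneq x0 => /(nm_eq0 um) ->.
Qed.

Lemma nm1 : nm 1 = 1.
Proof.
have n0 := lt0r_neq0 (nm_gt0 (oner_neq0 K)).
by apply: (mulfI n0); rewrite -(nmM um) !mulr1.
Qed.

Lemma nmN x : nm (- x) = nm x.
Proof.
rewrite -mulN1r (nmM um); suff -> : nm (-1) = 1 by rewrite mul1r.
by apply/eqP; rewrite -(@eqrXn2 _ 2) ?(nm_ge0 um) // expr2 -(nmM um) mulrNN mulr1 nm1 expr1n.
Qed.

Lemma nmB x y : nm (x - y) = nm (y - x).
Proof. by rewrite -nmN opprB. Qed.

Lemma nmX x n : nm (x ^+ n) = nm x ^+ n.
Proof. by elim: n => [|n IHn]; rewrite ?expr0 ?nm1 // !exprS (nmM um) IHn. Qed.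

Lemma nmV x : nm x^-1 = (nm x)^-1.
Proof.
have [->|x0] := eqVneq x 0; first by rewrite invr0 (nm0 um) invr0.
have n0 := lt0r_neq0 (nm_gt0 x0).
by apply: (mulfI n0); rewrite -(nmM um) !divff // nm1.
Qed.

Lemma nmD_le x y e : nm x <= e -> nm y <= e -> nm (x + y) <= e.
Proof. by move=> hx hy; apply: le_trans (nmD um x y) _; rewrite ge_max hx. Qed.

Lemma nmD_lt x y e : nm x < e -> nm y < e -> nm (x + y) < e.
Proof. by move=> hx hy; apply: le_lt_trans (nmD um x y) _; rewrite gt_max hx. Qed.

Lemma nm_trans_le y x z e : nm (x - y) <= e -> nm (y - z) <= e -> nm (x - z) <= e.
Proof. by move=> hx hy; rewrite -(subrKA y); apply: nmD_le. Qed.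

Lemma nm_trans_lt y x z e : nm (x - y) < e -> nm (y - z) < e -> nm (x - z) < e.
Proof. by move=> hx hy; rewrite -(subrKA y); apply: nmD_lt. Qed.

Lemma nm_sum (I : Type) (r : seq I) (F : I -> K) e :
  0 <= e -> (forall i, nm (F i) <= e) -> nm (\sum_(i <- r) F i) <= e.
Proof.
move=> e0 He; elim/big_ind: _ => //; first by rewrite (nm0 um).
by move=> x y; apply: nmD_le.
Qed.

(** The isosceles principle: the norm is locally constant away from zero. If [nm x < nm y], then
    [y = (y - x) + x] would have norm smaller than its own. *)
Lemma nm_eq_of_lt x y : nm (x - y) < nm y -> nm x = nm y.
Proof.
move=> h; apply: le_anti; apply/andP; split.
  by rewrite -(subrK y x) nmD_le // ltW.
rewrite leNgt; apply/negP => hx; rewrite nmB in h.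
by have := nmD_lt h hx; rewrite subrK ltxx.
Qed.

Lemma nm_small_eq0 x : (forall e, 0 < e -> nm x < e) -> x = 0.
Proof.
move=> hx; apply/eqP/negPn/negP => x0.
by have := hx _ (nm_gt0 x0); rewrite ltxx.
Qed.

(** * Limits and completeness *)

Definition tends u l := forall e, 0 < e -> eventually (fun n => nm (u n - l) < e).

Lemma tends_cst l : tends (fun=> l) l.
Proof. by move=> e e0; apply: eventuallyT => n; rewrite subrr (nm0 um). Qed.

Lemma tendsD u v l k : tends u l -> tends v k -> tends (fun n => u n + v n) (l + k).
Proof.
move=> ul vk e e0; apply: eventually_mono (eventually_and (ul e e0) (vk e e0)).
by move=> n [hu hv]; rewrite opprD addrACA; apply: nmD_lt.
Qed.

Lemma tends_bounded u l : tends u l -> eventually (fun n => nm (u n) <= Num.max 1 (nm l)).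
Proof.
move=> ul; apply: eventually_mono (ul 1 ltr01) => n h.
rewrite -(subrK l (u n)); apply: nmD_le; rewrite le_max ?lexx ?orbT //.
by rewrite ltW.
Qed.

Lemma tendsM u v l k : tends u l -> tends v k -> tends (fun n => u n * v n) (l * k).
Proof.
move=> ul vk e e0.
pose M := Num.max (Num.max 1 (nm l)) (nm k).
have M0 : 0 < M by rewrite /M !lt_max ltr01.
have eM : 0 < e / M by rewrite divr_gt0.
apply: eventually_mono
  (eventually_and (tends_bounded ul) (eventually_and (ul _ eM) (vk _ eM))).
move=> n [bu [hu hv]].
have -> : u n * v n - l * k = u n * (v n - k) + (u n - l) * k by ring.
rewrite !ltr_pdivlMr // in hu hv.
apply: nmD_lt; rewrite (nmM um).
  apply: le_lt_trans hv; rewrite mulrC ler_wpM2l ?(nm_ge0 um) //.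
  by rewrite le_max bu.
by apply: le_lt_trans hu; rewrite ler_wpM2l ?(nm_ge0 um) // le_max lexx orbT.
Qed.

Lemma tends_unique u l k : tends u l -> tends u k -> l = k.
Proof.
move=> ul uk; apply/eqP; rewrite -subr_eq0; apply/eqP/nm_small_eq0 => e e0.
have [n [h1 h2]] := eventually_ex (eventually_and (ul e e0) (uk e e0)).
by apply: (nm_trans_lt (y := u n)) => //; rewrite nmB.
Qed.

Lemma tends_neq0 u l : tends u l -> l != 0 -> eventually (fun n => u n != 0).
Proof.
move=> ul l0; apply: eventually_mono (ul _ (nm_gt0 l0)) => n.
by apply: contraTneq => ->; rewrite sub0r nmN ltxx.
Qed.

Lemma tends_nm_le u l e : tends u l -> (forall n, nm (u n) <= e) -> 0 <= e -> nm l <= e.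
Proof.
move=> ul ue e0; have [->|l0] := eqVneq l 0; first by rewrite (nm0 um).
have [n h] := eventually_ex (ul _ (nm_gt0 l0)).
by rewrite -(nm_eq_of_lt h).
Qed.

(** By the ultrametric inequality, small consecutive differences already make a sequence Cauchy, so
    this is the usual completeness. *)
Definition um_complete := forall u,
  (forall e, 0 < e -> eventually (fun n => nm (u n.+1 - u n) < e)) ->
  exists l, tends u l.

(** Telescoping leaves a factor of norm at most [r] beside [x - y]. This bounds the nonlinear part
    of the polynomial in [hensel]. *)
Lemma nm_exprB (x y : K) (r : rat) i : nm x <= r -> nm y <= r -> r <= 1 ->
  nm (x ^+ i.+2 - y ^+ i.+2) <= r * nm (x - y).
Proof.
move=> hx hy r1; have r0 : 0 <= r := le_trans (nm_ge0 um x) hx.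
have hX z j : nm z <= r -> nm (z ^+ j.+1) <= r.
  move=> hz; rewrite nmX exprS -[leRHS]mulr1.
  by rewrite ler_pM ?exprn_ge0 ?(nm_ge0 um) // exprn_ile1 ?(nm_ge0 um) // (le_trans hz).
have step j : x ^+ j.+1 - y ^+ j.+1 = x * (x ^+ j - y ^+ j) + (x - y) * y ^+ j.
  by rewrite !exprS; ring.
have small (j : nat) : nm (x ^+ j.+1 - y ^+ j.+1) <= nm (x - y).
  elim: j => [|j IHj]; first by rewrite !expr1.
  rewrite step; apply: nmD_le; rewrite (nmM um).
    by rewrite -[leRHS]mul1r ler_pM ?(nm_ge0 um) // (le_trans hx).
  by rewrite -[leRHS]mulr1 ler_wpM2l ?(nm_ge0 um) // (le_trans (hX _ _ hy)).
rewrite step; apply: nmD_le; rewrite (nmM um); first by rewrite ler_pM ?(nm_ge0 um).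
by rewrite mulrC ler_wpM2r ?(nm_ge0 um) // hX.
Qed.

(* Newton's iteration with the fixed slope [q`_1] is a contraction of the ball
   of radius [nm q`_0 / nm q`_1]. *)
Lemma hensel (q : {poly K}) (B : rat) : um_complete ->
  q`_1 != 0 -> (forall i, nm q`_i <= B) -> nm q`_0 * B < nm q`_1 ^+ 2 ->
  exists2 x, q.[x] = 0 & nm x <= nm q`_0 / nm q`_1.
Proof.
move=> compl q1 hB h0; have c0 := nm_gt0 q1.
have B0 : 0 <= B := le_trans (nm_ge0 um _) (hB 0%N).
set r := nm q`_0 / nm q`_1.
have r0 : 0 <= r by rewrite divr_ge0 ?(nm_ge0 um).
have r1 : r <= 1.
  rewrite ler_pdivrMr // mul1r -(ler_pM2r c0) -expr2; apply: le_trans (ltW h0).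
  by rewrite ler_wpM2l ?(nm_ge0 um).
(* Up to notation [k] is [|q_0| B / |q_1|^2], so the last hypothesis says exactly that [k < 1]. *)
pose k := B * r / nm q`_1.
have k0 : 0 <= k by apply: divr_ge0; [apply: mulr_ge0 | exact: (nm_ge0 um)].
have k1 : k < 1.
  by rewrite /k /r mulrA mulrAC -mulrA -invfM ltr_pdivrMr ?mulr_gt0 // mul1r mulrC -expr2.
pose T x := x - q.[x] / q`_1.
have Tlip x y : nm x <= r -> nm y <= r -> nm (T x - T y) <= k * nm (x - y).
  move=> hx hy.
  have -> : T x - T y = - (q.[x] - q.[y] - q`_1 * (x - y)) / q`_1.
    by rewrite /T; field.
  rewrite (nmM um) nmV nmN /k mulrAC ler_wpM2r ?invr_ge0 ?(nm_ge0 um) //.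
  (* Padding to length [(size q).+2] lets the constant and linear terms be split off whatever the
     degree; they cancel, and only degrees at least two remain. *)
  have le2 : (size q <= (size q).+2)%N by rewrite -addn2 leq_addr.
  rewrite !(horner_coef_wide _ le2) !big_ord_recl /= !expr0 !expr1.
  set sx := \sum_(i < _) _; set sy := \sum_(i < _) _.
  have -> : q`_0 * 1 + (q`_1 * x + sx) - (q`_0 * 1 + (q`_1 * y + sy)) -
     q`_1 * (x - y) = sx - sy by ring.
  rewrite /sx /sy -sumrB; apply: nm_sum => [|i].
    by apply: mulr_ge0; [apply: mulr_ge0 | exact: (nm_ge0 um)].
  by rewrite -mulrBr (nmM um) -mulrA ler_pM ?(nm_ge0 um) ?nm_exprB.
have T0 : nm (T 0) <= r.
  by rewrite /T sub0r nmN (nmM um) nmV horner_coef0.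
have Tball x : nm x <= r -> nm (T x) <= r.
  move=> hx; rewrite -(subrK (T 0) (T x)); apply: nmD_le => //.
  have n00 : nm 0 <= r by rewrite (nm0 um).
  apply: le_trans (Tlip x 0 hx n00) _; rewrite subr0 -[leRHS]mul1r.
  by rewrite ler_pM ?(nm_ge0 um) // ltW.
pose u n := iter n T 0.
have ub n : nm (u n) <= r.
  by elim: n => [|n IHn]; rewrite /u /= ?(nm0 um) // Tball.
have ud n : nm (u n.+1 - u n) <= k ^+ n * r.
  elim: n => [|n IHn]; first by rewrite expr0 mul1r subr0.
  rewrite exprS -mulrA; apply: le_trans (Tlip (u n.+1) (u n) (ub _) (ub _)) _.
  by rewrite ler_wpM2l.
have [|l ul] := compl u.
  move=> e e0.
  have [|N hN] := @expr_lt_eps k e _ e0; first by rewrite k0.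
  exists N => n Nn; apply: le_lt_trans (ud n) _.
  apply: le_lt_trans (_ : k ^+ n * r <= k ^+ n) _.
    by rewrite -[leRHS]mulr1 ler_wpM2l ?exprn_ge0.
  by apply: le_lt_trans hN; rewrite ler_wiXn2l // ltW.
have lr := tends_nm_le ul ub r0.
exists l => //.
have Tl : T l - l = 0.
  apply: nm_small_eq0 => e e0; have [N hN] := ul e e0.
  apply: (nm_trans_lt (y := u N.+1)); last exact/hN.
  apply: le_lt_trans (Tlip _ _ lr (ub N)) _.
  rewrite nmB; apply: le_lt_trans (hN N (leqnn _)).
  by rewrite -[leRHS]mul1r ler_wpM2r ?(nm_ge0 um) // ltW.
have {}Tl : q.[l] / q`_1 = 0.
  by apply: oppr_inj; rewrite oppr0 -[RHS]Tl /T; ring.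
by move/eqP: Tl; rewrite mulf_eq0 invr_eq0 (negPf q1) orbF => /eqP.
Qed.

End Ultrametric.

(** * Deformations of finitely generated subrings *)

Lemma exists_upper_bound (g : nat -> rat) k : exists2 B, 0 < B & forall i, (i < k)%N -> g i <= B.
Proof.
elim: k => [|k [B B0 HB]]; first by exists 1.
exists (Num.max B (g k)) => [|i]; first by rewrite lt_max B0.
rewrite ltnS leq_eqVlt => /predU1P[->|/HB h]; first by rewrite le_max lexx orbT.
by rewrite le_max h.
Qed.

Section Deformation.
Variables (K : fieldType) (nm : K -> rat) (um : ultrametric nm).
Local Notation tends := (tends nm).

(** The maps live on a ring [D] above the generated subring of [K]: for a fixed [n], [phin n] need
    not factor through the image of [phi], and a given relation in [K] is respected only for large
    [n]. *)
Record deforms (D : comNzRingType) (phi : {rmorphism D -> K})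
    (phin : nat -> {rmorphism D -> K}) : Prop := Deforms {
  deforms_tends : forall d, tends (fun n => phin n d) (phi d);
  deforms_ker : forall d, phi d = 0 -> eventually (fun n => phin n d = 0)
}.

Lemma tends_horner (D : comNzRingType) (phi : {rmorphism D -> K})
    (phin : nat -> {rmorphism D -> K}) (an : nat -> K) (a : K) :
    (forall d, tends (fun n => phin n d) (phi d)) -> tends an a ->
  forall P : {poly D},
    tends (fun n => (map_poly (phin n) P).[an n]) (map_poly phi P).[a].
Proof.
move=> cphi ca; elim/poly_ind => [|P c IHP].
  rewrite rmorph0 horner0 => e e0; apply: eventuallyT => n.
  by rewrite rmorph0 horner0 subrr (nm0 um).
have hornerMXC (f : {rmorphism D -> K}) y :
    (map_poly f (P * 'X + c%:P)).[y] = (map_poly f P).[y] * y + f c.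
  by rewrite rmorphD rmorphM /= map_polyX map_polyC hornerD hornerMX hornerC.
rewrite hornerMXC (_ : (fun n => _) = fun n => (map_poly (phin n) P).[an n] * an n + phin n c).
  by apply: (tendsD um) (cphi c); apply: (tendsM um).
by apply/funext => n; rewrite hornerMXC.
Qed.

Hypothesis compl : um_complete nm.
Hypothesis char0 : forall n, n.+1%:R != 0 :> K.

Lemma deriv_eq0_const (P : {poly K}) : P^`() = 0 -> (size P <= 1)%N.
Proof.
move=> dP; apply/leq_sizeP => j; case: j => // j _.
have := coef_deriv P j; rewrite dP coef0 -mulr_natr => /esym/eqP.
by rewrite mulf_eq0 (negPf (char0 j)) orbF => /eqP.
Qed.

(** Take [m] of least size among the polynomials with nonzero image that annihilate [a]. Then [a] is
    a simple root, so Hensel's lemma yields nearby roots [an n] of the deformed [m]; any other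
    relation [P] follows from [m] by pseudo-division. *)
Lemma adjoin_algebraic (D : comNzRingType) (phi : {rmorphism D -> K})
    (phin : nat -> {rmorphism D -> K}) (a : K) (P0 : {poly D}) :
    deforms phi phin -> map_poly phi P0 != 0 -> (map_poly phi P0).[a] = 0 ->
  exists2 an : nat -> K, tends an a &
    forall P : {poly D}, (map_poly phi P).[a] = 0 ->
      eventually (fun n => (map_poly (phin n) P).[an n] = 0).
Proof.
move=> [cphi kphi] P0n0 P0a.
pose ann (P : {poly D}) := map_poly phi P != 0 /\ (map_poly phi P).[a] = 0.
have [m [mn0 ma] mmin] : exists2 m, ann m & forall P, ann P -> (size m <= size P)%N.
  have ex : exists k, `[< exists2 P, ann P & size P = k >].
    by exists (size P0); apply/asboolP; exists P0.
  case: (ex_minnP ex) => k /asboolP[m am <-] kmin; exists m => // P aP.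
  by apply: kmin; apply/asboolP; exists P.
have min0 (P : {poly D}) : (size P < size m)%N -> (map_poly phi P).[a] = 0 -> map_poly phi P = 0.
  move=> szP Pa; apply/eqP/negPn/negP => Pn0.
  by move: szP; rewrite ltnNge mmin.
have m0 : m != 0 by apply: contraNneq mn0 => ->; rewrite rmorph0.
(* Otherwise deleting the leading term of [m] would leave its image unchanged, against
   minimality. *)
have lc0 : phi (lead_coef m) != 0.
  apply/eqP => l0; pose t := take_poly (size m).-1 m.
  have mt : map_poly phi t = map_poly phi m.
    apply/polyP => i; rewrite !coef_map /= coef_take_poly; case: ltnP => // hi.
    rewrite rmorph0; move: hi; rewrite leq_eqVlt => /predU1P[<-//|hi].
    by rewrite nth_default ?rmorph0 //; rewrite prednK ?size_poly_gt0 in hi.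
  case/negP: mn0; rewrite -mt min0 ?mt //.
  by rewrite (leq_ltn_trans (size_take_poly _ _)) // prednK ?size_poly_gt0.
pose b n i := (map_poly (phin n) m^`N(i)).[a].
pose c := (map_poly phi m^`()).[a].
(* The derivative is shorter than [m]: if it vanished at [a], its image would be zero, and in
   characteristic zero the image of [m] would be constant. *)
have c0 : c != 0.
  apply/eqP => ca; have := min0 _ (lt_size_deriv m0) ca.
  rewrite -deriv_map => /deriv_eq0_const/size1_polyC mC.
  by move: ma mn0; rewrite mC hornerC => ->; rewrite eqxx.
have cb i : tends (fun n => b n i) (map_poly phi m^`N(i)).[a].
  exact: tends_horner cphi (tends_cst um a) _.
have cb0 : tends (fun n => b n 0%N) 0 by have := cb 0%N; rewrite nderivn0 ma.
have cb1 : tends (fun n => b n 1%N) c by have := cb 1%N; rewrite nderivn1.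
(* [q n] is the Taylor expansion at [a] of the deformed [m]; its small root is the correction to be
   added to [a]. *)
pose q n := \poly_(i < size m) b n i.
have qE n u : (q n).[u] = (map_poly (phin n) m).[a + u].
  rewrite horner_poly (@nderiv_taylor_wide _ (size m)) ?size_map_poly_le //.
  - by apply: eq_bigr => i _; rewrite nderivn_map.
  - exact: mulrC.
  - exact: size_poly.
have sz2 : (1 < size m)%N.
  rewrite ltnNge; apply/negP => /size1_polyC mC.
  move: ma mn0; by rewrite mC map_polyC hornerC => ->; rewrite eqxx.
have q1E n : (q n)`_1 = b n 1%N by rewrite coef_poly sz2.
have q0E n : (q n)`_0 = b n 0%N by rewrite coef_poly (ltnW sz2).
(* These are the bounds that [tends_bounded] gives for the Taylor coefficients at large [n]; [B]
   dominates all of them. *)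
have [B B0 hB] := exists_upper_bound
  (fun i => Num.max 1 (nm (map_poly phi m^`N(i)).[a])) (size m).
have nc0 := nm_gt0 um c0.
have good : eventually (fun n => exists2 u, (q n).[u] = 0 & nm u <= nm (b n 0%N) / nm c).
  have evB := @eventually_ltn _ (size m) (fun i => tends_bounded um (cb i)).
  have e0 : 0 < nm c ^+ 2 / B by rewrite divr_gt0 ?exprn_gt0.
  have := eventually_and evB (eventually_and (cb1 _ nc0) (cb0 _ e0)).
  apply: eventually_mono => n [hb [/(nm_eq_of_lt um) h1]]; rewrite subr0 => h0.
  have [|i||u qu nu] := @hensel _ _ um (q n) B compl.
  - by rewrite q1E; apply: contraTneq nc0 => b0; rewrite -h1 b0 (nm0 um) ltxx.
  - rewrite coef_poly; case: ltnP => hi; last by rewrite (nm0 um) ltW.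
    exact: le_trans (hb i hi) (hB i hi).
  - by rewrite q1E q0E h1 -ltr_pdivlMr.
  by exists u => //; rewrite -h1 -q1E -q0E.
(* For an [n] without such a root, the correction defaults to 0. *)
have /choice[un hun] : forall n, exists u,
    (exists2 u, (q n).[u] = 0 & nm u <= nm (b n 0%N) / nm c) ->
    (q n).[u] = 0 /\ nm u <= nm (b n 0%N) / nm c.
  move=> n.
  have [[u ? ?]|no] := pselect (exists2 u, (q n).[u] = 0 & nm u <= nm (b n 0%N) / nm c).
    by exists u.
  by exists 0 => /no.
have {hun} ev := eventually_mono hun good.
have tan : tends (fun n => a + un n) a.
  move=> e e0; have ec : 0 < e * nm c by rewrite mulr_gt0.
  apply: eventually_mono (eventually_and ev (cb0 _ ec)) => n [[_ h]].
  by rewrite subr0 -ltr_pdivrMr // addrC addKr; apply: le_lt_trans.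
exists (fun n => a + un n) => // P Pa.
(* [m] need not be monic over [D], so a power of its leading coefficient appears; it can be
   cancelled for large [n] because [phi (lead_coef m)] is nonzero. *)
have divE := Pdiv.ComRing.rdivp_eq m P.
set r := Pdiv.Ring.rmodp P m in divE.
have mapE (f : {rmorphism D -> K}) y :
    f (lead_coef m) ^+ Pdiv.Ring.rscalp P m * (map_poly f P).[y] =
    (map_poly f (Pdiv.Ring.rdivp P m)).[y] * (map_poly f m).[y] + (map_poly f r).[y].
  by rewrite -hornerM -rmorphM -hornerD -rmorphD -divE /= map_polyZ hornerZ rmorphXn.
have r0 : map_poly phi r = 0.
  apply: min0; first by rewrite /r Pdiv.Ring.ltn_rmodpN0.
  by have := mapE phi a; rewrite Pa ma !mulr0 add0r.
have evr : eventually (fun n => map_poly (phin n) r = 0).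
  have hi i : eventually (fun n => phin n r`_i = 0).
    by apply: kphi; rewrite -coef_map r0 coef0.
  apply: eventually_mono (eventually_ltn (size r) hi) => n h.
  apply/polyP => i; rewrite coef_map coef0 /=.
  have [/h//|hs] := ltnP i (size r).
  by rewrite nth_default // rmorph0.
have evl := tends_neq0 um (cphi (lead_coef m)) lc0.
apply: eventually_mono (eventually_and evr (eventually_and evl ev)) => n [rn [ln [qn _]]].
have /eqP := mapE (phin n) (a + un n).
rewrite rn -qE qn mulr0 horner0 addr0 mulf_eq0 expf_eq0 (negPf ln) andbF /=.
by move/eqP.
Qed.

(** With [a] kept fixed, a relation holds at [a] only if all coefficients of [P] lie in the kernel
    of [phi]; these finitely many elements are eventually killed. *)
Lemma adjoin_transcendental (D : comNzRingType) (phi : {rmorphism D -> K})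
    (phin : nat -> {rmorphism D -> K}) (a : K) : deforms phi phin ->
    (forall P : {poly D}, (map_poly phi P).[a] = 0 -> map_poly phi P = 0) ->
  forall P : {poly D}, (map_poly phi P).[a] = 0 ->
    eventually (fun n => (map_poly (phin n) P).[a] = 0).
Proof.
move=> [_ kphi] tr P /tr P0.
have hi i : eventually (fun n => phin n P`_i = 0).
  by apply: kphi; rewrite -coef_map P0 coef0.
apply: eventually_mono (eventually_ltn (size P) hi) => n h.
suff -> : map_poly (phin n) P = 0 by rewrite horner0.
apply/polyP => i; rewrite coef_map coef0 /=.
have [/h//|hs] := ltnP i (size P).
by rewrite nth_default // rmorph0.
Qed.

Lemma adjoin (D : comNzRingType) (phi : {rmorphism D -> K})
    (phin : nat -> {rmorphism D -> K}) (a : K) : deforms phi phin ->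
  exists an : nat -> K,
    deforms (horner_eval a \o map_poly phi) (fun n => horner_eval (an n) \o map_poly (phin n)).
Proof.
move=> dphi; have [cphi _] := dphi.
have [[P0 P0n0 P0a]|no] := pselect (exists2 P0, map_poly phi P0 != 0 & (map_poly phi P0).[a] = 0).
  have [an tan kan] := adjoin_algebraic dphi P0n0 P0a.
  by exists an; split=> // P; exact: tends_horner.
exists (fun=> a); split=> [P|]; first exact: tends_horner cphi (tends_cst um a) P.
apply: adjoin_transcendental dphi _ => P Pa; apply/eqP/negPn/negP => Pn0.
by apply: no; exists P.
Qed.

(** Induction on [A], starting from [F[X]]. There transcendence makes [phi] injective, so the kernel
    condition is immediate; later steps keep the preimage of [x] as a constant polynomial. *)
Lemma deform_transcendental (F : fieldType) (iota : {rmorphism F -> K}) (x : K)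
    (en : nat -> K) (A : list K) :
    (forall P : {poly F}, (map_poly iota P).[x] = 0 -> P = 0) ->
    tends en 0 -> (forall n, en n != 0) ->
  exists (D : comNzRingType) (phi : {rmorphism D -> K}) (phin : nat -> {rmorphism D -> K}),
  [/\ deforms phi phin, forall a, List.In a A -> exists d, phi d = a &
      exists2 d, phi d = x & forall n, phin n d != x].
Proof.
move=> tr ten en0; elim: A => [|a A [D [phi [phin [dphi imA [dx phix phinx]]]]]].
  exists {poly F}, (horner_eval x \o map_poly iota),
    (fun n => horner_eval (x + en n) \o map_poly iota); split=> //.
  - split=> [P|P /tr ->]; last by apply: eventuallyT => n; rewrite rmorph0.
    apply: (tends_horner (phin := fun=> iota)) => [d|]; first exact: tends_cst.
    have := tendsD um (tends_cst um x) ten.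
    by rewrite addr0.
  - exists 'X => [|n]; rewrite /= /horner_eval map_polyX hornerX //.
    by rewrite -subr_eq0 addrAC subrr add0r.
have [an dan] := adjoin a dphi.
exists {poly D}, (horner_eval a \o map_poly phi),
  (fun n => horner_eval (an n) \o map_poly (phin n)).
split=> // [b [<-|/imA[d <-]]|].
- by exists 'X; rewrite /= /horner_eval map_polyX hornerX.
- by exists d%:P; rewrite /= /horner_eval map_polyC hornerC.
- by exists dx%:P => [|n]; rewrite /= /horner_eval map_polyC hornerC ?phix ?phinx.
Qed.

Lemma in_tilde_algebraic (F : fieldType) (iota : {rmorphism F -> K}) (x : K) (en : nat -> K) :
    tends en 0 -> (forall n, en n != 0) ->
    in_tilde +%R *%R 1 x ->
  exists2 P : {poly F}, P != 0 & (map_poly iota P).[x] = 0.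
Proof.
move=> ten en0 [A [xA Aad]]; apply: contrapT => no.
have tr (P : {poly F}) : (map_poly iota P).[x] = 0 -> P = 0.
  by move=> Px; apply/eqP/negPn/negP => P0; apply: no; exists P.
have [D [phi [phin [[cphi kphi] imA [dx phix phinx]]]]] := deform_transcendental A tr ten en0.
(* [lift] is an arbitrary choice of preimages and need not respect sums or products, but its defects
   lie in the kernel of [phi], hence are killed by [phin n] for large [n]. *)
have /choice[lift liftP] : forall a, exists d, List.In a A -> phi d = a.
  move=> a.
  have [/imA[d <-]|no'] := pselect (List.In a A); first by exists d.
  by exists 0 => /no'.
have ev1 : eventually (fun n => List.In 1 A -> phin n (lift 1) = 1).
  have [A1|no1] := pselect (List.In 1 A); last exact: eventuallyT.
  have := kphi (lift 1 - 1); rewrite rmorphB rmorph1 liftP // subrr => /(_ erefl).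
  by apply: eventually_mono => n; rewrite rmorphB rmorph1 => /subr0_eq.
(* Sums and products are treated at once: [op] is any binary operation preserved by ring
   morphisms. *)
have ev2 (op : forall R : nzRingType, R -> R -> R) :
    (forall (R S : nzRingType) (f : {rmorphism R -> S}) a b, f (op R a b) = op S (f a) (f b)) ->
    eventually (fun n => forall a, List.In a A -> forall b, List.In b A -> List.In (op K a b) A ->
      phin n (lift (op K a b)) = op K (phin n (lift a)) (phin n (lift b))).
  move=> opE; apply: eventually_In => a aA; apply: eventually_In => b bA.
  have [abA|nab] := pselect (List.In (op K a b) A); last exact: eventuallyT.
  have := kphi (lift (op K a b) - op D (lift a) (lift b)).
  rewrite rmorphB opE !liftP // subrr => /(_ erefl).
  by apply: eventually_mono => n; rewrite rmorphB opE => /subr0_eq.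
have evx : eventually (fun n => phin n (lift x) = phin n dx).
  have := kphi (lift x - dx); rewrite rmorphB liftP // phix subrr => /(_ erefl).
  by apply: eventually_mono => n; rewrite rmorphB => /subr0_eq.
have evD := ev2 (fun R => +%R) (fun R S f => rmorphD f).
have evM := ev2 (fun R => *%R) (fun R S f => rmorphM f).
have [n [h1 [hx [hD hM]]]] :=
  eventually_ex (eventually_and ev1 (eventually_and evx (eventually_and evD evM))).
have := Aad (fun a => phin n (lift a)); rewrite hx => fx.
have /eqP := phinx n; apply; apply: fx; split; first exact: h1.
by split=> a b aA bA; [apply: hD | apply: hM].
Qed.

End Deformation.

(** * Algebraic elements *)

Section Tilde.
Variable K : fieldType.
Local Notation hom := (adequate_hom (+%R : K -> K -> K) *%R 1).
Local Notation tilde := (in_tilde (+%R : K -> K -> K) *%R 1).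
Implicit Types (A : list K) (r s : K).

Lemma adequate_hom_incl A A' f : List.incl A A' -> hom A' f -> hom A f.
Proof.
move=> AA' [h1 [hD hM]]; split=> [/AA'/h1 //|].
by split=> a b /AA' aA /AA' bA /AA' cA; [apply: hD | apply: hM].
Qed.

Lemma adequate_hom_cat A A' f : hom (A ++ A') f -> hom A f /\ hom A' f.
Proof.
by move=> hf; split; apply: adequate_hom_incl hf => a aA; apply/List.in_or_app; [left|right].
Qed.

Lemma In_catl A A' r : List.In r A -> List.In r (A ++ A').
Proof. by move=> h; apply/List.in_or_app; left. Qed.

Lemma In_catr A A' r : List.In r A' -> List.In r (A ++ A').
Proof. by move=> h; apply/List.in_or_app; right. Qed.

Lemma in_tilde1 : tilde 1.
Proof. by exists [:: 1]; split=> [|f [h _]]; [left | apply: h; left]. Qed.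

Lemma in_tilde0 : tilde 0.
Proof.
exists [:: 0]; split=> [|f [_ [h _]]]; first by left.
have := h 0 0; rewrite addr0 => /(_ (or_introl erefl) (or_introl erefl) (or_introl erefl)).
by move/eqP; rewrite -subr_eq subrr => /eqP.
Qed.

(** Adequate sets for [r] and [s] pin down both values; adjoining [r + s] makes the sum condition
    applicable. Products work alike. *)
Lemma in_tildeD r s : tilde r -> tilde s -> tilde (r + s).
Proof.
move=> [A [rA hA]] [B [sB hB]]; exists ((A ++ B) ++ [:: r + s]).
split=> [|f hf]; first by apply: In_catr; left.
have [/adequate_hom_cat[/hA fr /hB fs] _] := adequate_hom_cat hf.
have [_ [hD _]] := hf; rewrite hD ?fr ?fs //.
- exact/In_catl/In_catl.
- exact/In_catl/In_catr.
- by apply: In_catr; left.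
Qed.

Lemma in_tildeM r s : tilde r -> tilde s -> tilde (r * s).
Proof.
move=> [A [rA hA]] [B [sB hB]]; exists ((A ++ B) ++ [:: r * s]).
split=> [|f hf]; first by apply: In_catr; left.
have [/adequate_hom_cat[/hA fr /hB fs] _] := adequate_hom_cat hf.
have [_ [_ hM]] := hf; rewrite hM ?fr ?fs //.
- exact/In_catl/In_catl.
- exact/In_catl/In_catr.
- by apply: In_catr; left.
Qed.

(** The value at [- r] is forced by [r + (- r) = 0], so an adequate set for 0 is included; inverses
    use 1 in the same way. *)
Lemma in_tildeN r : tilde r -> tilde (- r).
Proof.
move=> [A [rA hA]]; have [B [zB hB]] := in_tilde0; exists ((A ++ B) ++ [:: - r]).
split=> [|f hf]; first by apply: In_catr; left.
have [/adequate_hom_cat[/hA fr /hB f0] _] := adequate_hom_cat hf.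
have [_ [hD _]] := hf; apply: (addrI r); rewrite subrr -{1}fr -hD ?subrr //.
- exact/In_catl/In_catl.
- by apply: In_catr; left.
- exact/In_catl/In_catr.
Qed.

Lemma in_tildeV r : tilde r -> tilde r^-1.
Proof.
have [->|r0] := eqVneq r 0; first by rewrite invr0.
move=> [A [rA hA]]; have [B [oB hB]] := in_tilde1; exists ((A ++ B) ++ [:: r^-1]).
split=> [|f hf]; first by apply: In_catr; left.
have [/adequate_hom_cat[/hA fr /hB f1] _] := adequate_hom_cat hf.
have [_ [_ hM]] := hf; apply: (mulfI r0); rewrite divff // -{1}fr -hM ?divff //.
- exact/In_catl/In_catl.
- by apply: In_catr; left.
- exact/In_catl/In_catr.
Qed.

Lemma in_tilde_rat (iota : {rmorphism rat -> K}) q : tilde (iota q).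
Proof.
have nat_tilde n : tilde n%:R.
  elim: n => [|n IHn]; first exact: in_tilde0.
  by rewrite -addn1 natrD; apply: in_tildeD IHn in_tilde1.
have int_tilde (z : int) : tilde z%:~R.
  by case: z => n; [exact: nat_tilde | rewrite NegzE mulrNz; apply/in_tildeN/nat_tilde].
rewrite -(divq_num_den q) rmorphM fmorphV !rmorph_int.
by apply: in_tildeM; last apply: in_tildeV.
Qed.

(** [A] collects the intermediate values of Horner's scheme and adequate sets for the coefficients.
    The point [y] is arbitrary, so [f y] is not determined. *)
Lemma tilde_horner (P : {poly K}) (y : K) : (forall i, tilde P`_i) ->
  exists A, [/\ List.In y A, List.In P.[y] A & forall f, hom A f -> f P.[y] = P.[f y]].
Proof.
elim/poly_ind: P => [|P c IHP] hP.
  have [A [zA hA]] := in_tilde0; exists (A ++ [:: y]); split.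
  - by apply: In_catr; left.
  - by rewrite horner0; apply: In_catl.
  - by move=> f /adequate_hom_cat[/hA f0 _]; rewrite !horner0.
have [|A [yA PA hA]] := IHP.
  by move=> i; have := hP i.+1; rewrite coefD coefMX coefC addr0.
have [B [cB hB]] : tilde c by have := hP 0%N; rewrite coefD coefMX coefC add0r.
rewrite !hornerE.
exists ((A ++ B) ++ [:: P.[y] * y; P.[y] * y + c]); split.
- exact/In_catl/In_catl.
- by apply: In_catr; right; left.
move=> f hf; rewrite !hornerE.
have [/adequate_hom_cat[/hA fP /hB fc] _] := adequate_hom_cat hf.
have [_ [hD hM]] := hf.
have mA : List.In (P.[y] * y) ((A ++ B) ++ [:: P.[y] * y; P.[y] * y + c]).
  by apply: In_catr; left.
rewrite hD //; first last.
- by apply: In_catr; right; left.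
- exact/In_catl/In_catr.
by rewrite hM ?fP ?fc //; exact/In_catl/In_catl.
Qed.

End Tilde.

(** * Separating roots by means of the definable valuation ring *)

Section Algebraic.
Variables (K : fieldType) (nm : K -> rat) (um : ultrametric nm).
Local Notation tilde := (in_tilde (+%R : K -> K -> K) *%R 1).
Variables (p : nat) (iota : {rmorphism rat -> K}).
Hypothesis p_gt1 : (1 < p)%N.
Hypothesis compl : um_complete nm.
Hypothesis dense : forall (x : K) (e : rat), 0 < e -> exists q, nm (x - iota q) < e.
Hypothesis nm_range : forall x : K, x != 0 -> exists k : int, nm x = (p%:R : rat) ^ k.
Hypothesis nm_p : nm (iota p%:R) = p%:R^-1.

(* If [nm t > 1] then the valuation of [p t^2] is odd and negative, whereas a
   negative valuation of [y^2 + y] is even. *)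
Lemma nm_le1_of_solution (t y : K) : y ^+ 2 + y = iota p%:R * t ^+ 2 -> nm t <= 1.
Proof.
move=> yt; rewrite leNgt; apply/negP => t1.
have p0 : 0 < p%:R :> rat by rewrite ltr0n ltnW.
have p1 : 1 < p%:R :> rat by rewrite ltr1n.
have t0 : t != 0 by apply: contraTneq t1 => ->; rewrite (nm0 um).
have [k tk] := nm_range t0.
have nmy : nm (y ^+ 2 + y) = p%:R ^ (k *+ 2 - 1).
  by rewrite yt (nmM um) nm_p (nmX um) tk expfzDr ?lt0r_neq0 //
    mulr2n expfzDr ?lt0r_neq0 // expr2 mulrC.
have k0 : 0 < k by rewrite -(ltr_eXz2l p1) expr0z -tk.
have big : 1 < nm (y ^+ 2 + y).
  by rewrite nmy -(expr0z p%:R) ltr_eXz2l //; lia.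
have y1 : 1 < nm y.
  rewrite ltNge; apply/negP => y1; move: big; rewrite ltNge; case/negP.
  by apply: (nmD_le um) => //; rewrite (nmX um) exprn_ile1 // (nm_ge0 um).
have y0 : y != 0 by apply: contraTneq y1 => ->; rewrite (nm0 um).
have [j yj] := nm_range y0.
have : nm (y ^+ 2 + y) = nm (y ^+ 2).
  apply: (nm_eq_of_lt um); rewrite addrAC subrr add0r (nmX um) expr2.
  by rewrite ltr_pMl // (lt_trans ltr01).
rewrite nmy (nmX um) yj expr2 -expfzDr ?lt0r_neq0 //.
by move/(ieexprIz p0 (negbT (gt_eqF p1))); lia.
Qed.

(** Hensel's lemma at 0 for [Y^2 + Y - p t^2]: the slope is 1 and the constant term has norm at most
    [1 / p]. *)
Lemma solution_of_nm_le1 (t : K) : nm t <= 1 -> exists y, y ^+ 2 + y = iota p%:R * t ^+ 2.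
Proof.
move=> t1; pose c := iota p%:R * t ^+ 2; pose q : {poly K} := 'X^2 + 'X - c%:P.
have c1 : nm c < 1.
  rewrite (nmM um) (nmX um) nm_p; apply: le_lt_trans (_ : _ <= p%:R^-1) _.
    by rewrite ler_piMr ?invr_ge0 ?ler0n // exprn_ile1 ?(nm_ge0 um).
  by rewrite invf_lt1 ?ltr1n // ltr0n ltnW.
have q0 : q`_0 = - c by rewrite !coefE /= ?(addr0, add0r).
have q1 : q`_1 = 1 by rewrite !coefE /= ?(addr0, add0r, subr0, oppr0).
have [|i||y qy _] := @hensel _ _ um q 1 compl.
- by rewrite q1 oner_eq0.
- rewrite !coefE; case: i => [|[|[|i]]] /=;
    rewrite ?(add0r, addr0, subr0, sub0r) ?(nmN um) ?(nm1 um) ?(nm0 um) //.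
  exact: ltW.
- by rewrite q0 q1 (nmN um) (nm1 um) expr1n mulr1.
exists y; apply: subr0_eq; rewrite -[RHS]qy.
by rewrite /q hornerD hornerN hornerC hornerD hornerXn hornerX.
Qed.

(** A finite set records that [P] vanishes at [x] and, through the witness [w], that [(x - q) / p^N]
    is integral for a rational [q] near [x]. A map moving [x] sends it to another root with the same
    integrality. *)
Lemma close_root_of_not_tilde (P : {poly K}) (x : K) (N : nat) :
    (forall i, tilde P`_i) -> P.[x] = 0 -> ~ tilde x ->
  exists y, [/\ y != x, P.[y] = 0 & nm (y - x) <= p%:R^-1 ^+ N].
Proof.
move=> tP Px nx.
have p0 : 0 < p%:R :> rat by rewrite ltr0n ltnW.
pose pi := iota p%:R.
have pi0 : pi != 0 by rewrite fmorph_eq0 lt0r_neq0.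
have eN : 0 < p%:R^-1 ^+ N :> rat by rewrite exprn_gt0 ?invr_gt0.
have [q xq] := dense x eN.
have nmt z : nm ((z - iota q) / pi ^+ N) = nm (z - iota q) / p%:R^-1 ^+ N.
  by rewrite (nmM um) (nmV um) (nmX um) nm_p.
have [|w wE] := @solution_of_nm_le1 ((x - iota q) / pi ^+ N).
  by rewrite nmt ler_pdivrMr // mul1r ltW.
(* [R] is [p t^2] at [t = (z - q) / p^N], written as a polynomial in [z] with rational coefficients,
   so that the forced values apply to it. *)
pose R0 : {poly rat} := (p%:R / p%:R ^+ (N + N)) *: ('X - q%:P) ^+ 2.
pose R := map_poly iota R0.
have RE z : R.[z] = pi * ((z - iota q) / pi ^+ N) ^+ 2.
  rewrite /R map_polyZ rmorphXn /= map_polyXsubC !hornerE rmorphM fmorphV rmorphXn exprD.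
  by rewrite /= -/pi; field; rewrite expf_neq0.
have tR i : tilde R`_i by rewrite coef_map; apply: in_tilde_rat.
have tS i : tilde ('X^2 + 'X : {poly K})`_i.
  rewrite !coefE; apply: in_tildeD; [case: (_ == _) | case: (_ == _)];
  by [exact: in_tilde1 | exact: in_tilde0].
have [A [xA PA hA]] := tilde_horner x tP.
have [B [xB RB hB]] := tilde_horner x tR.
have [C [wC SC hC]] := tilde_horner w tS.
have [E [zE hE]] := in_tilde0 K.
(* Without such a root this union would be adequate for [x]. The part [E] forces [f 0 = 0], which
   makes [f x] a root of [P]. *)
apply: contrapT => no; apply: nx; exists (A ++ (B ++ (C ++ E))).
split=> [|f]; first exact: In_catl.
case/adequate_hom_cat=> /hA fP /adequate_hom_cat[/hB fR /adequate_hom_cat[/hC fS /hE f0]].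
apply/eqP/negPn/negP => fx; apply: no; exists (f x); split=> //.
  by rewrite -fP Px.
apply: (nm_trans_le um (y := iota q)); last by rewrite (nmB um) ltW.
rewrite -[leRHS]mul1r -ler_pdivrMr // -nmt.
apply: (@nm_le1_of_solution _ (f w)).
have SE z : ('X^2 + 'X : {poly K}).[z] = z ^+ 2 + z by rewrite hornerD hornerXn hornerX.
by rewrite -RE -fR RE -wE -!SE fS.
Qed.

(** Otherwise roots of [P] other than [x] converge to [x]. They are roots of the cofactor [Q] left
    after removing all factors [X - x], so by continuity [Q] vanishes at [x], a contradiction. *)
Lemma algebraic_in_tilde (P : {poly rat}) (x : K) :
  P != 0 -> (map_poly iota P).[x] = 0 -> tilde x.
Proof.
move=> P0 Px; apply: contrapT => nx.
have tP i : tilde (map_poly iota P)`_i by rewrite coef_map; apply: in_tilde_rat.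
have /choice[y hy] := fun N => close_root_of_not_tilde N tP Px nx.
have [k [Q Qx PQ]] := multiplicity_XsubC (map_poly iota P) x.
rewrite map_poly_eq0 P0 /= in Qx.
have Qy n : Q.[y n] = 0.
  have [yx Py _] := hy n; move/eqP: Py; rewrite PQ hornerM mulf_eq0.
  by rewrite horner_exp !hornerE expf_eq0 subr_eq0 (negPf yx) andbF orbF => /eqP.
have p1 : 0 <= (p%:R^-1 : rat) < 1.
  by rewrite invr_ge0 ler0n invf_lt1 ?ltr1n // ltr0n ltnW.
have ty : tends nm y x.
  move=> e e0; have [N hN] := expr_lt_eps p1 e0; exists N => n Nn.
  have [_ _ h] := hy n; apply: le_lt_trans h _; apply: le_lt_trans hN.
  by case/andP: p1 => a b; rewrite ler_wiXn2l // ltW.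
have id_tends (d : K) : tends nm (fun=> idfun d) (idfun d) := tends_cst um d.
have := @tends_horner _ _ um K idfun (fun=> idfun) y x id_tends ty Q.
rewrite !map_poly_id // => tQ.
case/negP: Qx; apply/rootP.
apply: (tends_unique um tQ).
rewrite (_ : (fun n => _) = fun=> 0); first exact: tends_cst.
by apply/funext => n; rewrite Qy.
Qed.

End Algebraic.

(** * The p-adic norm on the rationals *)

Section PadicNorm.
Variables (p : nat) (hp : prime p).
Local Notation nm := (padic_norm p).

Let p0 : (p%:R : rat) != 0.
Proof. by rewrite pnatr_eq0 -lt0n prime_gt0. Qed.

Let p1 : 1 < (p%:R : rat).
Proof. by rewrite ltr1n prime_gt1. Qed.

(** The fraction need not be reduced: cross-multiply with the reduced form and use that [logn p] is
    additive on nonzero products. *)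
Lemma padic_norm_frac (a b : int) : a != 0 -> b != 0 ->
  nm (a%:~R / b%:~R) = p%:R ^ ((logn p `|b|%N)%:Z - (logn p `|a|%N)%:Z).
Proof.
move=> a0 b0; set q := _ / _.
have b0' : b%:~R != 0 :> rat by rewrite intr_eq0.
have q0 : q != 0 by rewrite mulf_neq0 ?invr_eq0 ?intr_eq0.
rewrite /padic_norm (negPf q0) /padic_val; congr (_ ^ _).
have eqZ : numq q * b = a * denq q.
  apply: (@intr_inj rat); rewrite !rmorphM /=.
  have d0 : (denq q)%:~R != 0 :> rat by rewrite intr_eq0 denq_neq0.
  have := divq_num_den q; rewrite {3}/q => /eqP.
  by rewrite eqr_div // => /eqP.
have : (logn p (`|numq q| * `|b|) = logn p (`|a| * `|denq q|))%N.
  by rewrite -!abszM eqZ.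
rewrite !lognM ?absz_gt0 ?numq_eq0 ?denq_neq0 //; lia.
Qed.

Lemma padic_norm0 : nm 0 = 0.
Proof. by rewrite /padic_norm eqxx. Qed.

Lemma padic_norm_gt0 x : x != 0 -> 0 < nm x.
Proof. by move=> x0; rewrite /padic_norm (negPf x0) exprz_gt0 // (lt_trans ltr01). Qed.

Lemma padic_ultrametric : ultrametric nm.
Proof.
split.
- by move=> x; have [->|/padic_norm_gt0/ltW//] := eqVneq x 0; rewrite padic_norm0.
- by move=> x; apply: contra_eq => /padic_norm_gt0/lt0r_neq0.
- exact: padic_norm0.
- move=> x y; have [->|x0] := eqVneq x 0; first by rewrite mul0r padic_norm0 mul0r.
  have [->|y0] := eqVneq y 0; first by rewrite mulr0 padic_norm0 mulr0.
  rewrite -{1 2}(divq_num_den x) -{1 2}(divq_num_den y).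
  rewrite mulf_div -!intrM !padic_norm_frac ?mulf_neq0 ?numq_eq0 ?denq_neq0 //.
  rewrite -expfzDr // !abszM !lognM ?absz_gt0 ?numq_eq0 ?denq_neq0 //.
  congr (_ ^ _); lia.
- move=> x y; have [->|x0] := eqVneq x 0; first by rewrite add0r le_max lexx orbT.
  have [->|y0] := eqVneq y 0; first by rewrite addr0 le_max lexx.
  have [->|xy0] := eqVneq (x + y) 0.
    by rewrite padic_norm0 le_max (ltW (padic_norm_gt0 x0)).
  have [dx0 dy0] := (denq_neq0 x, denq_neq0 y).
  (* Over the common denominator [C], the inequality says that a power of [p] dividing [A] and [B]
     divides [A + B]. *)
  pose A := numq x * denq y; pose B := numq y * denq x; pose C := denq x * denq y.
  have C0 : C != 0 by rewrite mulf_neq0.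
  have xE : x = A%:~R / C%:~R.
    by rewrite -{1}(divq_num_den x) /A /C !intrM; field; rewrite !intr_eq0 dx0 dy0.
  have yE : y = B%:~R / C%:~R.
    by rewrite -{1}(divq_num_den y) /B /C !intrM; field; rewrite !intr_eq0 dx0 dy0.
  have A0 : A != 0 by rewrite mulf_neq0 ?numq_eq0.
  have B0 : B != 0 by rewrite mulf_neq0 ?numq_eq0.
  have xyE : x + y = (A + B)%:~R / C%:~R by rewrite xE yE -mulrDl rmorphD.
  have AB0 : A + B != 0.
    by apply: contraNneq xy0 => AB; rewrite xyE AB mul0r.
  rewrite xyE xE yE !padic_norm_frac // le_max !ler_eXz2l //.
  have minAB : (minn (logn p `|A|) (logn p `|B|) <= logn p `|(A + B)%R|)%N.
    set k := minn _ _; rewrite -pfactor_dvdn ?absz_gt0 //.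
    have dv (Z : int) : Z != 0 -> (k <= logn p `|Z|)%N -> ((p ^ k)%N %| Z)%Z.
      by move=> Z0 kZ; rewrite dvdzE /= pfactor_dvdn ?absz_gt0.
    have : ((p ^ k)%N %| A + B)%Z by rewrite rpredD ?dv // /k ?geq_minl ?geq_minr.
    by rewrite dvdzE.
  by lia.
Qed.

Lemma padic_norm_p : nm p%:R = p%:R^-1.
Proof.
have := @padic_norm_frac p 1; rewrite divr1 => -> //; last first.
  by rewrite eqz_nat -lt0n prime_gt0.
by rewrite /= logn1 logn_prime // eqxx.
Qed.

End PadicNorm.

(** * The field of p-adic numbers *)

Section QpField.
Variables (p : nat) (hp : prime p).
Local Notation nm := (padic_norm p).
Local Notation cauchy := (padic_cauchy p).
Local Notation equiv := (padic_equiv p).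
Let um := padic_ultrametric hp.
Implicit Types (u v w : nat -> rat) (X Y Z : Qp p).

Lemma padic_equiv_refl u : equiv u u.
Proof. by move=> e e0; exists 0%N => n _; rewrite subrr (nm0 um). Qed.

Lemma padic_equiv_sym u v : equiv u v -> equiv v u.
Proof. by move=> uv e e0; have [N hN] := uv e e0; exists N => n /hN; rewrite (nmB um). Qed.

Lemma padic_equiv_trans v u w : equiv u v -> equiv v w -> equiv u w.
Proof.
move=> uv vw e e0; have := eventually_and (uv e e0) (vw e e0).
by apply: eventually_mono => n [h1 h2]; apply: (nm_trans_lt um h1).
Qed.

Lemma padic_cauchy_bounded u : cauchy u -> exists2 B, 0 < B & eventually (fun n => nm (u n) <= B).
Proof.
move=> cu; have [N hN] := cu 1 ltr01; exists (Num.max 1 (nm (u N))).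
  by rewrite lt_max ltr01.
exists N => n Nn; rewrite -(subrK (u N) (u n)); apply: (nmD_le um); rewrite le_max ?lexx ?orbT //.
by rewrite ltW // hN.
Qed.

Lemma padic_cauchyD u v : cauchy u -> cauchy v -> cauchy (fun n => u n + v n).
Proof.
move=> cu cv e e0; have [[N hN] [M hM]] := (cu e e0, cv e e0).
exists (maxn N M) => m n; rewrite !geq_max => /andP[Nm Mm] /andP[Nn Mn].
by rewrite opprD addrACA; apply: (nmD_lt um); [apply: hN | apply: hM].
Qed.

Lemma padic_cauchyN u : cauchy u -> cauchy (fun n => - u n).
Proof.
move=> cu e e0; have [N hN] := cu e e0; exists N => m n Nm Nn.
by rewrite opprK addrC hN.
Qed.

Lemma padic_equivD u u' v v' : equiv u u' -> equiv v v' ->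
  equiv (fun n => u n + v n) (fun n => u' n + v' n).
Proof.
move=> uu' vv' e e0; apply: eventually_mono (eventually_and (uu' e e0) (vv' e e0)).
by move=> n [h1 h2]; rewrite opprD addrACA; apply: (nmD_lt um).
Qed.

(** Common estimate behind [padic_cauchyM] and [padic_equivM]. *)
Lemma nm_mulB_lt (a b a' b' B e : rat) : 0 < B -> nm a <= B -> nm b' <= B ->
  nm (a - a') < e / B -> nm (b - b') < e / B -> nm (a * b - a' * b') < e.
Proof.
move=> B0 aB bB; rewrite !ltr_pdivlMr // => h1 h2.
have -> : a * b - a' * b' = a * (b - b') + (a - a') * b' by ring.
apply: (nmD_lt um); rewrite (nmM um).
  by apply: le_lt_trans h2; rewrite mulrC ler_wpM2l ?(nm_ge0 um).
by apply: le_lt_trans h1; rewrite ler_wpM2l ?(nm_ge0 um).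
Qed.

Lemma padic_common_bound u v : cauchy u -> cauchy v ->
  exists2 B, 0 < B & eventually (fun n => nm (u n) <= B /\ nm (v n) <= B).
Proof.
move=> /padic_cauchy_bounded[B B0 hB] /padic_cauchy_bounded[C C0 hC].
exists (Num.max B C); first by rewrite lt_max B0.
apply: eventually_mono (eventually_and hB hC) => n [h1 h2].
by rewrite !le_max h1 h2 orbT.
Qed.

Lemma padic_cauchyM u v : cauchy u -> cauchy v -> cauchy (fun n => u n * v n).
Proof.
move=> cu cv e e0; have [B B0 [N1 hB]] := padic_common_bound cu cv.
have eB : 0 < e / B by rewrite divr_gt0.
have [[N2 hN] [N3 hM]] := (cu _ eB, cv _ eB).
exists (maxn N1 (maxn N2 N3)) => m n; rewrite !geq_max => /and3P[m1 m2 m3] /and3P[n1 n2 n3].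
have [[? _] [_ ?]] := (hB _ m1, hB _ n1).
by apply: (@nm_mulB_lt _ _ _ _ B) => //; [apply: hN | apply: hM].
Qed.

Lemma padic_equivM u u' v v' : cauchy u -> cauchy v' -> equiv u u' -> equiv v v' ->
  equiv (fun n => u n * v n) (fun n => u' n * v' n).
Proof.
move=> cu cv uu' vv' e e0; have [B B0 hB] := padic_common_bound cu cv.
have eB : 0 < e / B by rewrite divr_gt0.
have := eventually_and hB (eventually_and (uu' _ eB) (vv' _ eB)).
by apply: eventually_mono => n [[? ?] [? ?]]; apply: (@nm_mulB_lt _ _ _ _ B).
Qed.

Definition Qp_mk u (cu : cauchy u) : Qp p :=
  exist _ (padic_cls p u) (ex_intro _ u (conj cu erefl)).

Lemma Qp_val_inj X Y : proj1_sig X = proj1_sig Y -> X = Y.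
Proof. by case: X Y => [S hS] [T hT] /= ST; subst T; congr exist; apply: Prop_irrelevance. Qed.

Lemma padic_cls_eq u v : equiv u v -> padic_cls p u = padic_cls p v.
Proof.
move=> uv; apply/funext => w; apply/propext; split=> -[cw h]; split=> //.
  exact: padic_equiv_trans (padic_equiv_sym uv) h.
exact: padic_equiv_trans uv h.
Qed.

Lemma Qp_mk_eq u v (cu : cauchy u) (cv : cauchy v) : equiv u v -> Qp_mk cu = Qp_mk cv.
Proof. by move=> uv; apply: Qp_val_inj; apply: padic_cls_eq. Qed.

Lemma Qp_mk_ext u v (cu : cauchy u) (cv : cauchy v) : u =1 v -> Qp_mk cu = Qp_mk cv.
Proof. by move=> /funext uv; apply: Qp_mk_eq; rewrite uv; apply: padic_equiv_refl. Qed.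

Lemma Qp_rep_cauchy X : cauchy (Qp_rep X).
Proof.
by rewrite /Qp_rep; case: ClassicalEpsilon.constructive_indefinite_description => u /= [].
Qed.

Lemma Qp_mk_rep X : Qp_mk (Qp_rep_cauchy X) = X.
Proof.
apply: Qp_val_inj => /=; rewrite /Qp_rep.
by case: ClassicalEpsilon.constructive_indefinite_description => u /= [_ ->].
Qed.

Lemma QpP X : exists u (cu : cauchy u), X = Qp_mk cu.
Proof. by exists (Qp_rep X), (Qp_rep_cauchy X); rewrite Qp_mk_rep. Qed.

Lemma Qp_rep_mk u (cu : cauchy u) : equiv (Qp_rep (Qp_mk cu)) u.
Proof.
have := congr1 (@proj1_sig _ _) (Qp_mk_rep (Qp_mk cu)) => /= E.
have : padic_cls p u u by split; last exact: padic_equiv_refl.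
by rewrite -E => -[].
Qed.

(** [Qp_lift2] picks by [epsilon] a class containing the termwise result. Such a class is unique, so
    any equivalent Cauchy sequence [w] represents it. *)
Lemma Qp_lift2_mk op X Y w (cw : cauchy w) :
  equiv w (fun n => op (Qp_rep X n) (Qp_rep Y n)) ->
  cauchy (fun n => op (Qp_rep X n) (Qp_rep Y n)) -> Qp_lift2 op X Y = Qp_mk cw.
Proof.
move=> we cop; rewrite /Qp_lift2; set S := fun Z : Qp p => _.
have exS : exists Z, S Z by exists (Qp_mk cw).
have := epsilon_spec (inhabits (Qp_of_rat p 0)) S exS.
have [u [cu ->]] := QpP (epsilon (inhabits (Qp_of_rat p 0)) S); case=> _ ue.
by apply: Qp_mk_eq; apply: padic_equiv_trans ue _; apply: padic_equiv_sym.
Qed.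

Lemma Qp_add_mk u v (cu : cauchy u) (cv : cauchy v) :
  Qp_add (Qp_mk cu) (Qp_mk cv) = Qp_mk (padic_cauchyD cu cv).
Proof.
apply: Qp_lift2_mk; last by apply: padic_cauchyD; apply: Qp_rep_cauchy.
by apply: padic_equivD; apply: padic_equiv_sym; apply: Qp_rep_mk.
Qed.

Lemma Qp_mul_mk u v (cu : cauchy u) (cv : cauchy v) :
  Qp_mul (Qp_mk cu) (Qp_mk cv) = Qp_mk (padic_cauchyM cu cv).
Proof.
apply: Qp_lift2_mk; last by apply: padic_cauchyM; apply: Qp_rep_cauchy.
by apply: padic_equivM => //; try exact: Qp_rep_cauchy;
  apply: padic_equiv_sym; apply: Qp_rep_mk.
Qed.

Definition Qp_opp X : Qp p := Qp_mk (padic_cauchyN (Qp_rep_cauchy X)).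

Lemma Qp_opp_mk u (cu : cauchy u) : Qp_opp (Qp_mk cu) = Qp_mk (padic_cauchyN cu).
Proof.
apply: Qp_mk_eq => e e0; have [N hN] := Qp_rep_mk cu e0.
by exists N => n /hN; rewrite -opprD (nmN um).
Qed.

Lemma Qp_of_ratE q : Qp_of_rat p q = Qp_mk (padic_cst_cauchy p q).
Proof. by []. Qed.

Lemma Qp_addA : associative (@Qp_add p).
Proof.
move=> X Y Z; have [[u [cu ->]] [v [cv ->]] [w [cw ->]]] := And3 (QpP X) (QpP Y) (QpP Z).
by rewrite !Qp_add_mk; apply: Qp_mk_ext => n; rewrite addrA.
Qed.

Lemma Qp_addC : commutative (@Qp_add p).
Proof.
move=> X Y; have [[u [cu ->]] [v [cv ->]]] := (QpP X, QpP Y).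
by rewrite !Qp_add_mk; apply: Qp_mk_ext => n; rewrite addrC.
Qed.

Lemma Qp_add0 : left_id (Qp_of_rat p 0) (@Qp_add p).
Proof.
move=> X; have [u [cu ->]] := QpP X.
by rewrite Qp_of_ratE Qp_add_mk; apply: Qp_mk_ext => n; rewrite add0r.
Qed.

Lemma Qp_addN : left_inverse (Qp_of_rat p 0) Qp_opp (@Qp_add p).
Proof.
move=> X; have [u [cu ->]] := QpP X.
by rewrite Qp_of_ratE Qp_opp_mk Qp_add_mk; apply: Qp_mk_ext => n; rewrite addNr.
Qed.

Lemma Qp_mulA : associative (@Qp_mul p).
Proof.
move=> X Y Z; have [[u [cu ->]] [v [cv ->]] [w [cw ->]]] := And3 (QpP X) (QpP Y) (QpP Z).
by rewrite !Qp_mul_mk; apply: Qp_mk_ext => n; rewrite mulrA.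
Qed.

Lemma Qp_mulC : commutative (@Qp_mul p).
Proof.
move=> X Y; have [[u [cu ->]] [v [cv ->]]] := (QpP X, QpP Y).
by rewrite !Qp_mul_mk; apply: Qp_mk_ext => n; rewrite mulrC.
Qed.

Lemma Qp_mul1 : left_id (Qp_one p) (@Qp_mul p).
Proof.
move=> X; have [u [cu ->]] := QpP X.
by rewrite /Qp_one Qp_of_ratE Qp_mul_mk; apply: Qp_mk_ext => n; rewrite mul1r.
Qed.

Lemma Qp_mulDl : left_distributive (@Qp_mul p) (@Qp_add p).
Proof.
move=> X Y Z; have [[u [cu ->]] [v [cv ->]] [w [cw ->]]] := And3 (QpP X) (QpP Y) (QpP Z).
by rewrite Qp_add_mk !Qp_mul_mk Qp_add_mk; apply: Qp_mk_ext => n; rewrite mulrDl.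
Qed.

Lemma Qp_mk_equiv u v (cu : cauchy u) (cv : cauchy v) : Qp_mk cu = Qp_mk cv -> equiv u v.
Proof.
move=> /(congr1 (@proj1_sig _ _)) /= E.
have : padic_cls p v v by split; last exact: padic_equiv_refl.
by rewrite -E => -[].
Qed.

Lemma Qp_of_rat_inj : injective (Qp_of_rat p).
Proof.
move=> q r /Qp_mk_equiv qr; apply/eqP; rewrite -subr_eq0; apply/eqP.
apply: (nm_small_eq0 um) => e e0; have [N hN] := qr e e0.
exact: (hN N).
Qed.

(** Some [e] admits arbitrarily late terms of norm at least [e]. Take one, [u m], beyond the Cauchy
    index for [e]: by the isosceles principle all terms beyond that index have its norm. *)
Lemma padic_norm_eventually_cst u : cauchy u -> ~ equiv u (fun=> 0) ->
  exists2 q : rat, q != 0 & eventually (fun n => nm (u n) = nm q).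
Proof.
move=> cu /existsNP[e]; rewrite not_implyP => -[e0 /forallNP he].
have [N hN] := cu e e0.
have /existsNP[m] := he N; rewrite not_implyP => -[Nm /negP].
rewrite subr0 -leNgt => em; exists (u m).
  by apply: contraTneq em => ->; rewrite (nm0 um) -ltNge.
exists N => n Nn; apply: (nm_eq_of_lt um).
exact: lt_le_trans (hN n m Nn Nm) em.
Qed.

(** Termwise inverses form a Cauchy sequence because the norms are eventually a nonzero constant. *)
Lemma Qp_mul_inv_ex X : X <> Qp_of_rat p 0 -> exists Y, Qp_mul Y X = Qp_one p.
Proof.
have [u [cu ->]] := QpP X => u0.
have [|q q0 [N hN]] := padic_norm_eventually_cst cu.
  by move=> uz; apply: u0; apply: Qp_mk_eq.
have nq := nm_gt0 um q0.
have un0 n : (N <= n)%N -> u n != 0.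
  by move=> /hN hn; apply: contraTneq nq => u0'; rewrite -hn u0' (nm0 um) ltxx.
have ci : cauchy (fun n => (u n)^-1).
  move=> e e0; have eq : 0 < e * nm q ^+ 2 by rewrite mulr_gt0 ?exprn_gt0.
  have [M hM] := cu _ eq.
  exists (maxn N M) => m n; rewrite !geq_max => /andP[Nm Mm] /andP[Nn Mn].
  have -> : (u m)^-1 - (u n)^-1 = (u n - u m) / (u m * u n).
    by field; rewrite !un0.
  rewrite (nmM um) (nmV um) (nmM um) !hN // ltr_pdivrMr ?mulr_gt0 // -expr2.
  exact: hM.
exists (Qp_mk ci); rewrite Qp_mul_mk; apply: Qp_mk_eq => e e0.
by exists N => n /un0 n0; rewrite mulVf // subrr (nm0 um).
Qed.

(** The value 0 at 0 is the convention of the field structure. *)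
Definition Qp_inv X : Qp p :=
  if `[< X = Qp_of_rat p 0 >] then Qp_of_rat p 0 else
  epsilon (inhabits (Qp_of_rat p 0)) (fun Y => Qp_mul Y X = Qp_one p).

Lemma Qp_mulV X : X <> Qp_of_rat p 0 -> Qp_mul (Qp_inv X) X = Qp_one p.
Proof.
move=> X0; rewrite /Qp_inv; case: asboolP => // _.
exact: (epsilon_spec _ (fun Y => Qp_mul Y X = Qp_one p) (Qp_mul_inv_ex X0)).
Qed.

Lemma Qp_inv0 : Qp_inv (Qp_of_rat p 0) = Qp_of_rat p 0.
Proof. by rewrite /Qp_inv; case: asboolP. Qed.

End QpField.

(* The field laws of [Qp p] hold only for prime [p], hence the alias
   remembering the primality proof. *)
Definition padic (p : nat) (hp : prime p) : Type := Qp p.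

(** * Field structure and embedding of the rationals *)

Section PadicInstances.
Variables (p : nat) (hp : prime p).

HB.instance Definition _ := gen_eqMixin (padic hp).
HB.instance Definition _ := gen_choiceMixin (padic hp).
HB.instance Definition _ := GRing.isZmodule.Build (padic hp)
  (Qp_addA hp) (Qp_addC hp) (Qp_add0 hp) (Qp_addN hp).

Lemma padic_one_neq0 : (Qp_one p : padic hp) != 0.
Proof. by apply/eqP => /(Qp_of_rat_inj hp)/eqP; rewrite oner_eq0. Qed.

HB.instance Definition _ := GRing.Zmodule_isComNzRing.Build (padic hp)
  (Qp_mulA hp) (Qp_mulC hp) (Qp_mul1 hp) (Qp_mulDl hp) padic_one_neq0.

Lemma padic_mulVf (x : padic hp) : x != 0 -> (Qp_inv x : padic hp) * x = 1.
Proof. by move/eqP; apply: Qp_mulV. Qed.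

HB.instance Definition _ := GRing.ComNzRing_isField.Build (padic hp)
  padic_mulVf (Qp_inv0 p).

Definition padic_of_rat (q : rat) : padic hp := Qp_of_rat p q.

Lemma padic_of_rat_zmod : zmod_morphism padic_of_rat.
Proof.
move=> q r; rewrite /padic_of_rat; apply/esym.
rewrite [LHS](_ : _ = Qp_add (Qp_of_rat p q) (Qp_opp (Qp_of_rat p r))) //.
by rewrite !Qp_of_ratE (Qp_opp_mk hp) (Qp_add_mk hp); apply: (Qp_mk_ext hp).
Qed.

Lemma padic_of_rat_monoid : monoid_morphism padic_of_rat.
Proof.
split=> // q r; rewrite /padic_of_rat; apply/esym.
rewrite [LHS](_ : _ = Qp_mul (Qp_of_rat p q) (Qp_of_rat p r)) //.
by rewrite !Qp_of_ratE (Qp_mul_mk hp); apply: (Qp_mk_ext hp).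
Qed.

HB.instance Definition _ := GRing.isZmodMorphism.Build rat (padic hp)
  padic_of_rat padic_of_rat_zmod.
HB.instance Definition _ := GRing.isMonoidMorphism.Build rat (padic hp)
  padic_of_rat padic_of_rat_monoid.

End PadicInstances.

(** * The norm of p-adic numbers *)

Section QpNorm.
Variables (p : nat) (hp : prime p).
Local Notation nm := (padic_norm p).
Local Notation cauchy := (padic_cauchy p).
Local Notation K := (padic hp).
Let um := padic_ultrametric hp.

(** The strict upper bounds eventually valid along a representative determine [r] among nonnegative
    numbers; the first clause provides nonnegativity. *)
Definition is_Qp_norm (X : K) (r : rat) := (exists q, r = nm q) /\
  forall e, 0 < e -> (r < e <-> eventually (fun n => nm (Qp_rep X n) < e)).

Definition Qp_norm (X : K) : rat := epsilon (inhabits 0) (is_Qp_norm X).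

Lemma Qp_norm_spec (X : K) : is_Qp_norm X (Qp_norm X).
Proof.
apply: epsilon_spec.
have cX := Qp_rep_cauchy X.
have [X0|/(padic_norm_eventually_cst hp cX)[q q0 evq]] :=
    pselect (padic_equiv p (Qp_rep X) (fun=> 0)).
  exists 0; split; first by exists 0; rewrite (nm0 um).
  move=> e e0; split=> // _; apply: eventually_mono (X0 e e0) => n.
  by rewrite subr0.
exists (nm q); split; first by exists q.
move=> e e0; split=> [qe|h].
  by apply: eventually_mono evq => n ->.
by have [n [<-]] := eventually_ex (eventually_and evq h).
Qed.

Lemma Qp_norm_mk_lt u (cu : cauchy u) e : 0 < e ->
  Qp_norm (Qp_mk cu) < e <-> eventually (fun n => nm (u n) < e).
Proof.
move=> e0; have [_ /(_ e e0) ->] := Qp_norm_spec (Qp_mk cu).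
have ev := Qp_rep_mk hp cu e0.
split=> h; apply: eventually_mono (eventually_and h ev) => n [hn hr].
  rewrite -(subrK (Qp_rep (Qp_mk cu) n) (u n)); apply: (nmD_lt um) => //.
  by rewrite (nmB um).
by rewrite -(subrK (u n) (Qp_rep _ n)); apply: (nmD_lt um).
Qed.

Lemma Qp_norm_ge0 (X : K) : 0 <= Qp_norm X.
Proof. by have [[q ->] _] := Qp_norm_spec X; apply: (nm_ge0 um). Qed.

Lemma Qp_norm_mk u (cu : cauchy u) (q : rat) :
  eventually (fun n => nm (u n) = nm q) -> Qp_norm (Qp_mk cu) = nm q.
Proof.
move=> evq; apply: le_anti; apply/andP; split; rewrite leNgt; apply/negP => h.
  have e0 : 0 < Qp_norm (Qp_mk cu) := le_lt_trans (nm_ge0 um q) h.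
  suff : Qp_norm (Qp_mk cu) < Qp_norm (Qp_mk cu) by rewrite ltxx.
  by apply/(Qp_norm_mk_lt cu e0); apply: eventually_mono evq => n ->.
have e0 : 0 < nm q := le_lt_trans (Qp_norm_ge0 _) h.
have [n [un]] := eventually_ex (eventually_and evq ((Qp_norm_mk_lt cu e0).1 h)).
by rewrite un ltxx.
Qed.

Lemma Qp_norm_of_rat q : Qp_norm (padic_of_rat hp q) = nm q.
Proof. by apply: (@Qp_norm_mk (fun=> q) (padic_cst_cauchy p q)); exists 0%N. Qed.

Lemma Qp_norm_eq0 (X : K) : Qp_norm X = 0 -> X = 0.
Proof.
have [u [cu ->]] := QpP X => u0; apply: (Qp_mk_eq hp) => e e0.
have : Qp_norm (Qp_mk cu) < e by rewrite u0.
by move/(Qp_norm_mk_lt cu e0); apply: eventually_mono => n; rewrite subr0.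
Qed.

Lemma Qp_norm_neq0 u (cu : cauchy u) : (Qp_mk cu : K) != 0 ->
  exists2 q : rat, q != 0 & eventually (fun n => nm (u n) = nm q).
Proof.
move=> u0; apply: (padic_norm_eventually_cst hp cu) => uz.
by case/eqP: u0; apply: (Qp_mk_eq hp).
Qed.

Lemma padic_mulE u v (cu : cauchy u) (cv : cauchy v) :
  (Qp_mk cu : K) * (Qp_mk cv : K) = Qp_mk (padic_cauchyM hp cu cv).
Proof. exact: Qp_mul_mk. Qed.

Lemma padic_addE u v (cu : cauchy u) (cv : cauchy v) :
  (Qp_mk cu : K) + (Qp_mk cv : K) = Qp_mk (padic_cauchyD hp cu cv).
Proof. exact: Qp_add_mk. Qed.

Lemma padic_subE u v (cu : cauchy u) (cv : cauchy v) :
  (Qp_mk cu : K) - (Qp_mk cv : K) = Qp_mk (padic_cauchyD hp cu (padic_cauchyN cv)).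
Proof. by rewrite -padic_addE -(Qp_opp_mk hp). Qed.

Lemma Qp_ultrametric : ultrametric Qp_norm.
Proof.
have norm0 : Qp_norm 0 = 0 by rewrite -(rmorph0 (padic_of_rat hp)) Qp_norm_of_rat (nm0 um).
split=> //; [exact: Qp_norm_ge0 | exact: Qp_norm_eq0 | |].
- move=> X Y; have [->|] := eqVneq X 0; first by rewrite mul0r norm0 mul0r.
  have [->|] := eqVneq Y 0; first by rewrite mulr0 norm0 mulr0.
  have [[u [cu ->]] [v [cv ->]]] := (QpP X, QpP Y).
  move=> /Qp_norm_neq0[r r0 evr] /Qp_norm_neq0[q q0 evq].
  rewrite padic_mulE (Qp_norm_mk cu evq) (Qp_norm_mk cv evr) -(nmM um).
  apply: Qp_norm_mk; apply: eventually_mono (eventually_and evq evr) => n [h1 h2].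
  by rewrite !(nmM um) h1 h2.
- move=> X Y; rewrite leNgt gt_max; apply/negP => /andP[].
  have [[u [cu ->]] [v [cv ->]]] := (QpP X, QpP Y).
  (* The norm of the sum serves as its own bound: both terms are eventually below [e], hence so is
     the sum, giving [e < e]. *)
  set e := Qp_norm (_ + _) => hu hv.
  have e0 : 0 < e := le_lt_trans (Qp_norm_ge0 _) hu.
  move/(Qp_norm_mk_lt cu e0): hu => hu; move/(Qp_norm_mk_lt cv e0): hv => hv.
  suff : e < e by rewrite ltxx.
  rewrite {1}/e padic_addE; apply/(Qp_norm_mk_lt _ e0).
  by apply: eventually_mono (eventually_and hu hv) => n [h1 h2]; apply: (nmD_lt um).
Qed.

Lemma Qp_dense (X : K) (e : rat) : 0 < e -> exists q, Qp_norm (X - padic_of_rat hp q) < e.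
Proof.
have [u [cu ->]] := QpP X => e0; have [N hN] := cu e e0; exists (u N).
rewrite /padic_of_rat Qp_of_ratE padic_subE; apply/(Qp_norm_mk_lt _ e0).
by exists N => n Nn; apply: hN.
Qed.

Lemma Qp_norm_range (X : K) : X != 0 -> exists k : int, Qp_norm X = (p%:R : rat) ^ k.
Proof.
have [u [cu ->]] := QpP X => /Qp_norm_neq0[q q0 evq]; rewrite (Qp_norm_mk cu evq).
by exists (- padic_val p q); rewrite /padic_norm (negPf q0).
Qed.

Lemma padic_cauchy_of_step (u : nat -> rat) :
  (forall e, 0 < e -> eventually (fun n => nm (u n.+1 - u n) < e)) -> cauchy u.
Proof.
move=> hu e e0; have [N hN] := hu e e0.
have step k : nm (u (N + k)%N - u N) < e.
  elim: k => [|k IHk]; first by rewrite addn0 subrr (nm0 um).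
  by apply: (nm_trans_lt um _ IHk); rewrite addnS hN // leq_addr.
exists N => m n Nm Nn; rewrite -(subnKC Nm) -(subnKC Nn).
by apply: (nm_trans_lt um (step _)); rewrite (nmB um).
Qed.

(** Approximate [x n] by a rational [r n] to within [2^-n]; then [r] is Cauchy, and its class is the
    limit. *)
Lemma Qp_complete : um_complete Qp_norm.
Proof.
move=> x hx; have uK := Qp_ultrametric.
have e0 n : 0 < (2^-1 : rat) ^+ n by rewrite exprn_gt0.
have /choice[r hr] := fun n => Qp_dense (x n) (e0 n).
have half1 : 0 <= (2^-1 : rat) < 1 by [].
have evr e : 0 < e -> eventually (fun n => Qp_norm (x n - padic_of_rat hp (r n)) < e).
  move=> ep; have [N hN] := expr_lt_eps half1 ep; exists N => n Nn.
  apply: lt_trans (hr n) _; apply: le_lt_trans hN.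
  by apply: ler_wiXn2l.
have cr : cauchy r.
  apply: padic_cauchy_of_step => e ep; have [[N hN] [M hM]] := (evr e ep, hx e ep).
  exists (maxn N M) => n; rewrite geq_max => /andP[Nn Mn].
  rewrite -Qp_norm_of_rat rmorphB /=.
  apply: (nm_trans_lt uK (y := x n.+1)); first by rewrite (nmB uK) hN // leqW.
  by apply: (nm_trans_lt uK (y := x n)); [apply: hM | apply: hN].
exists (Qp_mk cr) => e ep.
have [N hN] := cr e ep.
have ev : eventually (fun n => Qp_norm (padic_of_rat hp (r n) - (Qp_mk cr : K)) < e).
  exists N => n Nn; rewrite /padic_of_rat Qp_of_ratE padic_subE; apply/(Qp_norm_mk_lt _ ep).
  by exists N => m Nm; apply: hN.
apply: eventually_mono (eventually_and (evr e ep) ev) => n [h1 h2].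
exact: (nm_trans_lt uK h1).
Qed.

Lemma Qp_hornerE (P : {poly rat}) (x : K) :
  Qp_horner P x = (map_poly (padic_of_rat hp) P).[x].
Proof.
rewrite map_polyE /Qp_horner; elim: (P : seq rat) => [|c s IHs] /=.
  by rewrite horner0.
by rewrite IHs horner_cons addrC.
Qed.

End QpNorm.

(** * The two inclusions for the p-adic numbers *)

Theorem theorem7 (p : nat) (hp : prime p) (x : Qp p) :
  in_tilde (@Qp_add p) (@Qp_mul p) (Qp_one p) x <-> Qp_algebraic x.
Proof.
pose K := padic hp; pose iota : {rmorphism rat -> K} := padic_of_rat hp.
have uK := Qp_ultrametric hp.
have p0 : (p%:R : rat) != 0 by rewrite pnatr_eq0 -lt0n prime_gt0.
have nm_p : Qp_norm (iota p%:R) = p%:R^-1 by rewrite Qp_norm_of_rat padic_norm_p.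
split=> [tx|[P [P0 Px]]]; last first.
  have := @algebraic_in_tilde K _ uK p iota (prime_gt1 hp) (@Qp_complete _ hp)
    (@Qp_dense _ hp) (@Qp_norm_range _ hp) nm_p P x P0.
  by apply; rewrite -Qp_hornerE Px.
(* The perturbations of [x] are the powers [p^n], nonzero and tending to zero p-adically. *)
have en0 n : iota (p%:R ^+ n) != 0 by rewrite fmorph_eq0 expf_neq0.
have ten : tends (@Qp_norm p hp) (fun n => iota (p%:R ^+ n)) 0.
  have p1 : 0 <= (p%:R^-1 : rat) < 1.
    by rewrite invr_ge0 ler0n invf_lt1 ?ltr1n ?prime_gt1 // ltr0n prime_gt0.
  move=> e e0; have [N hN] := expr_lt_eps p1 e0; exists N => n Nn.
  rewrite subr0 rmorphXn (nmX uK) nm_p; apply: le_lt_trans hN.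
  by case/andP: p1 => a b; rewrite ler_wiXn2l // ltW.
have char0 n : n.+1%:R != 0 :> K by rewrite -(rmorph_nat iota) fmorph_eq0 pnatr_eq0.
have [P P0 Px] := @in_tilde_algebraic K _ uK (@Qp_complete _ hp) char0 rat iota x _ ten en0 tx.
by exists P; split=> //; rewrite (@Qp_hornerE _ hp) Px.
Qed.
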